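(* Let $d\ge 2$ and let $f(x)=x^d+c\in\mathbb{Q}[x]$, where $c=c_1/c_2$ with $c_1\in\mathbb{Z}$ and $c_2\in\mathbb{Z}^+$ relatively prime. Let $u_1/u_2$ be a rational periodic point of $f(x)$ of exact period $n$, where $u_1\in\mathbb{Z}$, $u_2\in\mathbb{Z}^+$ are relatively prime. For $j\ge 1$ set $u_{1,j}=u_2\, f^j(u_1/u_2)$. Assume, moreover, that there is a prime $p\mid c_1$ such that $\gcd(p,d^n-1)=1$. Then $p\nmid (u_{1,i}-u_{1,j})$ for all $i\neq j$ with $1\le i,j\le n$. In particular, $$p\;\Big|\; \frac{u_{1,i}^{d^n-1}-u_{1,j}^{d^n-1}}{u_{1,i}-u_{1,j}}$$ for all such $i\ne j$.
   Context: The iterates of $f$ are $f^1=f$ and $f^m(x)=f(f^{m-1}(x))$ for $m\ge 2$. A point $u\in\mathbb{Q}$ is a periodic point of exact period $n$ if $n$ is the smallest positive integer with $f^n(u)=u$. In this situation $c_2=u_2^d$, every point of the orbit of $u_1/u_2$ has denominator $u_2$ in lowest terms, and so $u_{1,j}\in\mathbb{Z}$; equivalently $u_{1,j}=(g\circ h)^j(u_1)$ with $h(x)=x^d+c_1$ and $g(x)=x/u_2^{d-1}$. *)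

(* Defs.v *)
From mathcomp Require Import all_boot all_order all_algebra.

Set Implicit Arguments.
Unset Strict Implicit.
Unset Printing Implicit Defensive.

Import GRing.Theory.
Local Open Scope ring_scope.

Definition unicritical (d : nat) (c : rat) : {poly rat} := 'X^d + c%:P.

Definition poly_iter (f : {poly rat}) (m : nat) (x : rat) : rat :=
  iter m (horner f) x.

Definition exact_period (f : {poly rat}) (n : nat) (u : rat) : Prop :=
  [/\ (0 < n)%N,
      poly_iter f n u = u
    & forall m : nat, (0 < m)%N -> poly_iter f m u = u -> (n <= m)%N].

(* The number u_{1,j} = u_2 f^j(u_1/u_2), a priori only rational; when u_1/u_2
   is a periodic point of 'X^d + c it is an integer. *)
Definition orbit_numerator (f : {poly rat}) (u1 u2 : int) (j : nat) : rat :=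
  u2%:~R * poly_iter f j (u1%:~R / u2%:~R).

(* Main.v *)
Require Import Defs.
From mathcomp Require Import all_boot all_order all_algebra.

Set Implicit Arguments.
Unset Strict Implicit.
Unset Printing Implicit Defensive.

Import Order.TTheory GRing.Theory Num.Theory.
Local Open Scope ring_scope.

(** Put [x_j = f^j(u1/u2)].

    Denominators.  Fix a prime [q] and write [b_j], [g] for the exponents of
    [q] in the denominators of [x_j] and [c].  In [x_{j+1} = x_j^d + c] the
    denominator of each term divides the lcm of the two others, so no one of
    the exponents [d b_j], [b_{j+1}], [g] exceeds both others.  Were
    [d b_j > g], this would force [b_{j+1} >= d b_j], and the exponents would
    grow along the orbit for ever, contradicting periodicity; so they never
    exceed [g / d], and then [d b_j = g] ([cycle_slopes]).  Hence every [x_j]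
    has denominator [u2], and [c2 = u2^d] ([denq_cycle]).  The integers
    [u_{1,j}] are thus the numerators of the [x_j], and a prime [p] dividing
    [c1] does not divide [u2].

    Reduction mod [p].  As [p] divides [c1], the map reduces to the power map
    [t |-> t^d] on ['F_p] ([power_orbit]).  Its [n]-th iterate has derivative
    [d^n t^(d^n-1)], which equals [0] or [d^n] at a fixed point [t].  As [p]
    does not divide [d^n - 1], this multiplier is not [1], so the fixed points
    of the iterate are simple and each lifts to at most one point of period
    dividing [n] in characteristic zero; distinct points of the cycle therefore
    stay distinct mod [p] ([cycle_congruence]).  The uniqueness of the lift is
    made elementary by telescoping: for two orbits [y], [z] the factor
    [(y_k^d - z_k^d) / (y_k - z_k)] is a polynomial in [y_k], [z_k], the product
    of these factors once round the cycle is a power of [u2], and mod [p] it is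
    the multiplier times that same power of [u2].

    The quotient.  The [u_{1,j} / u2] are either all zero mod [p] or all
    [(d^n-1)]-st roots of unity.  The first is impossible as soon as there
    are two of them, so [p] divides [u_{1,i}^(d^n-1) - u_{1,j}^(d^n-1)] but not
    [u_{1,i} - u_{1,j}]. *)

(** * Denominators along a cycle *)

Lemma intr_mul_dvd_denq (m : int) (x : rat) :
  (m%:~R * x \is a Num.int) = (denq x %| m)%Z.
Proof.
apply/idP/idP => [/intrP[k mxk] | /dvdzP[k ->]]; last first.
  by rewrite intrM -mulrA [_ * x]mulrC -numqE -intrM intr_int.
have: (denq x %| m * numq x)%Z.
  apply/dvdzP; exists k; apply: (@intr_inj rat).
  by rewrite !intrM numqE mulrA mxk.
by rewrite Gauss_dvdzl // coprimez_sym; apply: coprime_num_den.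
Qed.

Lemma denqX (x : rat) d : denq (x ^+ d) = denq x ^+ d.
Proof.
have den_x_d : denq x ^+ d != 0 by rewrite expf_neq0 ?denq_neq0.
have -> : x ^+ d = (numq x ^+ d)%:~R / (denq x ^+ d)%:~R.
  by rewrite -{1}[x]divq_num_den expr_div_n !rmorphXn.
rewrite coprimeq_den ?(negPf den_x_d) ?normrX ?normr_denq //.
by rewrite !abszX coprimeXl // coprimeXr // coprime_num_den.
Qed.

Lemma denqD_dvd (x y : rat) :
  (`|denq (x + y)| %| lcmn `|denq x| `|denq y|)%N.
Proof.
have lcm_int (z : rat) : (`|denq z| %| lcmn `|denq x| `|denq y|)%N =
    ((lcmn `|denq x| `|denq y|)%:Z%:~R * z \is a Num.int).
  by rewrite intr_mul_dvd_denq dvdzE.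
by rewrite lcm_int mulrDr rpredD // -lcm_int ?dvdn_lcml ?dvdn_lcmr.
Qed.

(** Read [b j] and [g] as the exponents of one prime in the denominators of
    [x_j] and [c].  An index with [d * b j > g] would start an endless increase
    of [b], whereas on a periodic [b] bounded by [g / d] the term [b j.+1] is
    too small to allow [d * b j < g]. *)
Lemma cycle_slopes (d n g : nat) (b : nat -> nat) :
  (2 <= d)%N -> (0 < n)%N -> (forall j, b (j + n)%N = b j) ->
  (forall j, d * b j <= maxn (b j.+1) g)%N ->
  (forall j, g <= maxn (d * b j) (b j.+1))%N ->
  forall j, (d * b j)%N = g.
Proof.
move=> d_ge2 n_gt0 per leb leg.
have slope_le j : (d * b j <= g)%N.
  rewrite leqNgt; apply/negP => gtg.
  have grow k : (g < d * b (j + k))%N && (b j + k <= b (j + k))%N.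
    elim: k => [|k /andP[gtk lek]]; first by rewrite !addn0 gtg /=.
    have step : (d * b (j + k) <= b (j + k).+1)%N.
      by move: (leb (j + k)%N); rewrite leq_max [(_ <= g)%N]leqNgt gtk orbF.
    have bk_gt0 : (0 < b (j + k))%N.
      by rewrite lt0n; apply: contraTneq gtk => ->; rewrite muln0.
    have bk_lt : (b (j + k) < b (j + k).+1)%N.
      apply: leq_trans step; apply: (@leq_trans (2 * b (j + k))).
        by rewrite mul2n -addnn -addn1 leq_add2l.
      by rewrite leq_mul2r d_ge2 orbT.
    rewrite !addnS (leq_ltn_trans lek bk_lt) andbT.
    by apply: leq_trans gtk _; rewrite leq_mul2l (ltnW bk_lt) orbT.
  have /andP[_] := grow n.
  by rewrite per -{2}[b j]addn0 leq_add2l leqNgt n_gt0.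
move=> j; apply/eqP; rewrite eqn_leq slope_le /= leqNgt.
apply/negP => ltg.
have leg_bS : (g <= b j.+1)%N.
  by move: (leg j); rewrite leq_max leqNgt ltg.
have bS_le : (2 * b j.+1 <= b j.+1)%N.
  apply: leq_trans leg_bS; apply: leq_trans (slope_le j.+1).
  by rewrite leq_mul2r d_ge2 orbT.
have bS0 : b j.+1 = 0%N.
  by apply/eqP; rewrite -leqn0 -(leq_add2l (b j.+1)) addn0 addnn -mul2n.
by move: ltg leg_bS; rewrite bS0 leqn0 => ltg /eqP g0; rewrite g0 in ltg.
Qed.

Lemma denq_cycle (d n : nat) (c : rat) (x : nat -> rat) :
  (2 <= d)%N -> (0 < n)%N -> (forall j, x (j + n)%N = x j) ->
  (forall j, x j.+1 = x j ^+ d + c) ->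
  forall j, denq (x j) ^+ d = denq c.
Proof.
move=> d_ge2 n_gt0 per rec j.
have den_gt0 (z : rat) : (0 < `|denq z|)%N by rewrite absz_gt0 denq_neq0.
rewrite -denqX -absz_denq -(absz_denq c) denqX abszX; congr Posz.
apply: eqn_from_log => [||q]; rewrite ?expn_gt0 ?den_gt0 // lognX.
pose b i := logn q `|denq (x i)|.
apply: (@cycle_slopes d n _ b) => // i; rewrite /b ?per //.
  rewrite -lognX -abszX -denqX -logn_lcm //.
  apply: dvdn_leq_log; first by rewrite lcmn_gt0 !den_gt0.
  have -> : x i ^+ d = x i.+1 + - c by rewrite rec addrK.
  by rewrite -(denqN c) denqD_dvd.
rewrite -lognX -abszX -denqX -logn_lcm //.
apply: dvdn_leq_log; first by rewrite lcmn_gt0 !den_gt0.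
have -> : c = - x i ^+ d + x i.+1 by rewrite rec addKr.
by rewrite -(denqN (x i ^+ d)) denqD_dvd.
Qed.

(** * Reduction modulo a prime dividing the constant term *)

(** Here [e x' = x^d + a] is the homogenised form, with [e = u^(d-1)], of the
    recurrence for the numerators; each factor of the product is
    [(y_k^d - z_k^d) / (y_k - z_k)], so the differences telescope. *)
Lemma orbit_differences (R : comNzRingType) (d : nat) (e a : R)
    (y z : nat -> R) :
  (forall k, e * y k.+1 = y k ^+ d + a) ->
  (forall k, e * z k.+1 = z k ^+ d + a) ->
  forall m, e ^+ m * (y m - z m) =
    (y 0%N - z 0%N) * \prod_(k < m) \sum_(i < d) y k ^+ (d.-1 - i) * z k ^+ i.
Proof.
move=> recy recz; elim=> [|m IHm]; first by rewrite big_ord0 mulr1 mul1r.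
rewrite big_ord_recr /= mulrA -IHm exprSr -!mulrA -subrXX mulrBr recy recz.
by rewrite opprD addrACA subrr addr0.
Qed.

Lemma power_orbit (F : fieldType) (d : nat) (u : F) (y : nat -> F) :
  (0 < d)%N -> u != 0 -> (forall k, u ^+ d.-1 * y k.+1 = y k ^+ d) ->
  forall k, y k / u = (y 0%N / u) ^+ (d ^ k).
Proof.
move=> d_gt0 u0 rec; elim=> [|k IHk]; first by rewrite expn0 expr1.
rewrite expnSr exprM -IHk expr_div_n -rec -{2}(prednK d_gt0) exprSr.
by rewrite -mulf_div divff ?mul1r // expf_neq0.
Qed.

(** The chain rule: the left side is the product of the derivatives [d x^(d-1)]
    of [x |-> x^d] along the orbit of [t], the right side the derivative of
    [x |-> x^(d^m)] at [t]. *)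
Lemma power_map_multiplier (R : comNzRingType) (d : nat) (t : R) m :
  (0 < d)%N ->
  \prod_(k < m) (((t ^+ (d ^ k)) ^+ d.-1) *+ d) = t ^+ (d ^ m).-1 *+ (d ^ m).
Proof.
move=> d_gt0; elim: m => [|m IHm]; first by rewrite big_ord0.
rewrite big_ord_recr /= IHm mulrnAl mulrnAr -mulrnA -exprM -exprD -expnS.
congr (_ ^+ _ *+ _).
have dm_gt0 : (0 < d ^ m)%N by rewrite expn_gt0 d_gt0.
by rewrite -!subn1 mulnBr muln1 addnBAC // subnKC ?expnSr // leq_pmulr.
Qed.

(** The telescoped product of difference quotients is a pure power of [u],
    because the differences come back to their nonzero initial value; when the
    two orbits agree mod [p] the same product is also that power of [u] times
    the multiplier.  So the multiplier is [1] in ['F_p], and a multiplier [1]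
    rules out [t = 0] unless [d^n = 1], leaving [d^n = 1] in ['F_p]. *)
Lemma cycle_congruence (p d n : nat) (u a : int) (y z : nat -> int) :
  prime p -> (0 < d)%N -> ~~ (p %| u)%Z -> (p %| a)%Z ->
  (forall k, u ^+ d.-1 * y k.+1 = y k ^+ d + a) ->
  (forall k, u ^+ d.-1 * z k.+1 = z k ^+ d + a) ->
  y n = y 0%N -> z n = z 0%N -> y 0%N != z 0%N -> (p %| y 0%N - z 0%N)%Z ->
  (p %| d ^ n - 1)%N.
Proof.
move=> p_pr d_gt0; rewrite !(dvdz_pcharf (pchar_Fp p_pr)).
set U : 'F_p := u%:~R => U0 /eqP a0 recy recz yn zn y0z0 yz0.
have redrec (v : nat -> int) : (forall k, u ^+ d.-1 * v k.+1 = v k ^+ d + a) ->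
    forall k, U ^+ d.-1 * (v k.+1)%:~R = (v k)%:~R ^+ d :> 'F_p.
  move=> rec k; have := congr1 (intr : int -> 'F_p) (rec k).
  by rewrite intrM intrD !rmorphXn /= a0 addr0.
have Yk := power_orbit d_gt0 U0 (redrec y recy).
have Zk := power_orbit d_gt0 U0 (redrec z recz).
have Z0Y0 : (z 0%N)%:~R = (y 0%N)%:~R :> 'F_p.
  by apply/eqP; rewrite eq_sym -subr_eq0 -intrB.
set t : 'F_p := (y 0%N)%:~R / U.
have YE k : (y k)%:~R = t ^+ (d ^ k) * U :> 'F_p by rewrite -Yk divfK.
have ZE k : (z k)%:~R = t ^+ (d ^ k) * U :> 'F_p.
  by rewrite /t -Z0Y0 -Zk divfK.
(* Once round the cycle the difference returns to its first value, which cancels. *)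
have := orbit_differences recy recz n; rewrite yn zn mulrC.
move/(mulfI _) => /(_ _)/(congr1 (intr : int -> 'F_p)); rewrite subr_eq0.
move=> /(_ y0z0); rewrite !rmorphXn /= rmorph_prod /=.
under eq_bigr => k _.
  have -> : (\sum_(i < d) y k ^+ (d.-1 - i) * z k ^+ i)%:~R =
      U ^+ d.-1 * ((t ^+ (d ^ k)) ^+ d.-1 *+ d) :> 'F_p.
    rewrite rmorph_sum /= (eq_bigr (fun=> U ^+ d.-1 * (t ^+ (d ^ k)) ^+ d.-1)).
      by rewrite sumr_const card_ord -mulrnAr.
    move=> i _; rewrite intrM !rmorphXn /= YE ZE -exprD subnK.
      by rewrite exprMn mulrC.
    by rewrite -ltnS prednK.
  over.
rewrite big_split /= prodr_const card_ord power_map_multiplier //.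
rewrite -{1}[_ ^+ n]mulr1 => /(mulfI _) mult1.
have {}mult1 : 1 = t ^+ (d ^ n).-1 *+ d ^ n by apply: mult1; rewrite !expf_neq0.
have dn_gt0 : (0 < d ^ n)%N by rewrite expn_gt0 d_gt0.
have tn : t ^+ (d ^ n) = t by rewrite -Yk yn.
have t_unit : t ^+ (d ^ n).-1 = 1.
  have [t0|t0] := eqVneq t 0; last first.
    by apply: (mulIf t0); rewrite -exprSr prednK // tn mul1r.
  (* A nonzero multiplier at 0 leaves only the exponent d ^ n - 1 = 0. *)
  apply/eqP; move/eqP: mult1; rewrite t0 expr0n; case: (_ == 0%N) => //=.
  by rewrite mul0rn oner_eq0.
rewrite t_unit in mult1.
rewrite (dvdn_pcharf (pchar_Fp p_pr)) natrB // -mult1.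
by rewrite subrr.
Qed.

(** * Points of exact period n *)

Lemma iter_period_inj (T : Type) (f : T -> T) (n : nat) (x : T) :
  iter n f x = x ->
  (forall m, (0 < m)%N -> iter m f x = x -> (n <= m)%N) ->
  forall i j, (1 <= i <= n)%N -> (1 <= j <= n)%N ->
  iter i f x = iter j f x -> i = j.
Proof.
move=> fn min i j; wlog lt_ij : i j / (i < j)%N.
  move=> IH Hi Hj eq_ij; case: (ltngtP i j) => // lt_ij; first exact: IH.
  by apply/esym/IH.
move=> /andP[i_gt0 le_in] /andP[_ le_jn] eq_ij.
have le_ij := ltnW lt_ij.
(* Applying f another n - i times brings the i-th iterate back to x. *)
have: iter (j - i) f x = x.
  have := congr1 (iter (n - i) f) eq_ij.
  rewrite -!iterD subnK // fn => {2}->.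
  by rewrite addnC addnBA // -addnBAC // iterD fn.
move/(min _); rewrite subn_gt0 lt_ij => /(_ isT).
rewrite leq_subRL // => le_inj.
have := leq_trans le_inj le_jn.
by rewrite -{2}[n]add0n leq_add2r leqNgt i_gt0.
Qed.

Theorem theorem5p2 (d : nat) (hd : (2 <= d)%N)
    (c1 c2 : int) (hc2 : 0 < c2) (hc : coprimez c1 c2)
    (u1 u2 : int) (hu2 : 0 < u2) (hu : coprimez u1 u2)
    (n : nat)
    (hper : exact_period (unicritical d (c1%:~R / c2%:~R)) n
              (u1%:~R / u2%:~R))
    (p : nat) (hp : prime p) (hpc1 : (p%:Z %| c1)%Z)
    (hpd : coprime p (d ^ n - 1)) :
  exists u1_ : nat -> int,
    (forall j : nat, (1 <= j)%N ->
       (u1_ j)%:~R =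
       orbit_numerator (unicritical d (c1%:~R / c2%:~R)) u1 u2 j) /\
    (forall i j : nat, (1 <= i <= n)%N -> (1 <= j <= n)%N -> i <> j ->
       ~~ (p%:Z %| u1_ i - u1_ j)%Z /\
       (p%:Z %| (u1_ i ^+ (d ^ n - 1) - u1_ j ^+ (d ^ n - 1))
                %/ (u1_ i - u1_ j))%Z).
Proof.
case: hper => n_gt0 fn min_n.
set c : rat := c1%:~R / c2%:~R in fn min_n *.
set x0 : rat := u1%:~R / u2%:~R in fn min_n *.
pose x j := poly_iter (unicritical d c) j x0.
have d_gt0 : (0 < d)%N by apply: ltnW.
have rec j : x j.+1 = x j ^+ d + c.
  by rewrite /x /poly_iter iterS /unicritical hornerD hornerXn hornerC.
have per j : x (j + n)%N = x j by rewrite /x /poly_iter iterD [iter n _ _]fn.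
have den_c : denq c = c2.
  by rewrite coprimeq_den // gt_eqF // gtr0_norm.
have den_x0 : denq x0 = u2.
  by rewrite coprimeq_den // gt_eqF // gtr0_norm.
have den_cycle := denq_cycle hd n_gt0 per rec.
have c2E : c2 = u2 ^+ d by rewrite -den_c -(den_cycle 0) den_x0.
have den_x j : denq (x j) = u2.
  apply/eqP; rewrite -(@eqrXn2 _ d) ?denq_ge0 ?(ltW hu2) //.
  by rewrite den_cycle den_c c2E.
have u2_neq0 : (u2%:~R : rat) != 0 by rewrite intr_eq0 gt_eqF.
pose u j := numq (x j).
have uE j : (u j)%:~R = u2%:~R * x j by rewrite numqE den_x mulrC.
have recu j : u2 ^+ d.-1 * u j.+1 = u j ^+ d + c1.
  apply: (@intr_inj rat); rewrite intrM intrD !rmorphXn /= !uE.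
  rewrite rec mulrA -exprSr prednK // mulrDr exprMn; congr (_ + _).
  by rewrite /c c2E rmorphXn mulrC divfK // expf_neq0.
have peru j : u (j + n)%N = u j by rewrite /u per.
have p_u2 : ~~ (p %| u2)%Z.
  apply/negP => pu2.
  have p_c2 : (p %| c2)%Z by rewrite c2E dvdz_exp.
  have: (p%:Z %| gcdz c1 c2)%Z by rewrite dvdz_gcd hpc1.
  by move/eqP: hc => ->; rewrite dvdzE /= dvdn1 => /eqP p1; rewrite p1 in hp.
have distinct i j : (1 <= i <= n)%N -> (1 <= j <= n)%N -> i <> j -> u i != u j.
  move=> Hi Hj neq_ij; apply/eqP => eq_u; apply: neq_ij.
  apply: (iter_period_inj fn min_n) => //.
  by apply: (mulfI u2_neq0); rewrite -!/(poly_iter _ _ _) -!/(x _) -!uE eq_u.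
have incongruent i j : (1 <= i <= n)%N -> (1 <= j <= n)%N -> i <> j ->
    ~~ (p %| u i - u j)%Z.
  move=> Hi Hj neq_ij; apply/negP => p_uij.
  have p_dn : (p %| d ^ n - 1)%N.
    apply: (@cycle_congruence p d n u2 c1
              (fun k => u (i + k)%N) (fun k => u (j + k)%N)) => //.
    - by move=> k; rewrite addnS.
    - by move=> k; rewrite addnS.
    - by rewrite peru addn0.
    - by rewrite peru addn0.
    - by rewrite !addn0 distinct.
    - by rewrite !addn0.
  by move: hpd; rewrite prime_coprime // p_dn.
exists u; split=> [j _ | i j Hi Hj neq_ij]; first by rewrite uE.
have p_uij := incongruent i j Hi Hj neq_ij; split=> //.
have uij0 : u i - u j != 0 by rewrite subr_eq0 distinct.
have quot_dvd : (u i - u j %| u i ^+ (d ^ n - 1) - u j ^+ (d ^ n - 1))%Z.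
  by rewrite subrXX dvdz_mulr.
have p_cop : coprimez p (u i - u j).
  by rewrite coprimezE prime_coprime.
rewrite -(Gauss_dvdzl _ p_cop) divzK //.
move: p_uij; rewrite !(dvdz_pcharf (pchar_Fp hp)) !rmorphB !rmorphXn /=.
have U0 : u2%:~R != 0 :> 'F_p by rewrite -(dvdz_pcharf (pchar_Fp hp)).
have recF k : u2%:~R ^+ d.-1 * (u k.+1)%:~R = (u k)%:~R ^+ d :> 'F_p.
  have := congr1 (intr : int -> 'F_p) (recu k).
  rewrite intrM intrD !rmorphXn /=.
  by move: hpc1; rewrite (dvdz_pcharf (pchar_Fp hp)) => /eqP ->; rewrite addr0.
have uF := power_orbit d_gt0 U0 recF.
set t : 'F_p := (u 0%N)%:~R / u2%:~R in uF.
have uFE k : (u k)%:~R = t ^+ (d ^ k) * u2%:~R :> 'F_p by rewrite -uF divfK.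
move=> neq_F.
have t_neq0 : t != 0.
  apply: contraNneq neq_F => t0; rewrite !uFE t0.
  by rewrite !expr0n !expn_eq0 (gtn_eqF d_gt0) /= subrr.
have t_unit : t ^+ (d ^ n - 1) = 1.
  apply: (mulIf t_neq0); rewrite -exprSr subn1 prednK ?expn_gt0 ?d_gt0 //.
  by rewrite -uF -[n]add0n peru mul1r.
have power_k k : (u k)%:~R ^+ (d ^ n - 1) = u2%:~R ^+ (d ^ n - 1) :> 'F_p.
  by rewrite uFE exprMn exprAC t_unit expr1n mul1r.
by rewrite !power_k subrr.
Qed.
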